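(* Let $\Gamma$ be a trivalent, 3-edge-connected metric graph with first Betti number $g$. Then there is a tropically independent set of $3g-3$ functions in $2R(K_\Gamma)$.
   Context: Metric graphs are compact and connected. $\Gamma$ is trivalent if it has a model (underlying finite graph) in which every vertex has valence 3; it is 3-edge-connected if it remains connected after removing the interiors of any two edges of this model. For a point $v\in\Gamma$, $\operatorname{val}(v)$ is the valence (number of outgoing directions) of $v$. The canonical divisor $K_\Gamma$ is given by $\deg_v(K_\Gamma)=\operatorname{val}(v)-2$. For a continuous piecewise linear function $\psi$ with integer slopes on $\Gamma$, $\operatorname{div}(\psi)$ is the divisor whose multiplicity at $v$ is the sum of the incoming slopes of $\psi$ at $v$ (i.e. minus the sum of the outgoing slopes). For a divisor $D$ on $\Gamma$, $R(D)$ is the set of piecewise linear functions $\psi$ with integer slopes on $\Gamma$ such that $\operatorname{div}(\psi)+D$ is effective. $2R(K_\Gamma)$ is the set of functions of the form $\psi_1+\psi_2$ with $\psi_1,\psi_2\in R(K_\Gamma)$. A finite set of piecewise linear functions $\{\psi_0,\dots,\psi_n\}$ on $\Gamma$ is tropically dependent if there are real numbers $b_0,\dots,b_n$ such that for every $v\in\Gamma$ the minimum $\min\{\psi_0(v)+b_0,\dots,\psi_n(v)+b_n\}$ is attained by at least two indices. Otherwise it is tropically independent. *)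

(* Defs.v *)
From HB Require Import structures.
From mathcomp Require Import all_boot all_order all_algebra.
From mathcomp Require Import boolp classical_sets reals.

Set Implicit Arguments.
Unset Strict Implicit.
Unset Printing Implicit Defensive.

Import Order.TTheory GRing.Theory Num.Theory.

Local Open Scope classical_set_scope.
Local Open Scope ring_scope.

(* The multigraph on V whose edges are the e with [A e]; a connected graph is
   nonempty. *)
Definition graph_connected (V E : finType) (src tgt : E -> V) (A : pred E) :=
  (0 < #|V|)%N /\
  forall u v : V,
    connect (fun x y => [exists e, A e &&
      ((src e == x) && (tgt e == y) || (src e == y) && (tgt e == x))]) u v.

(* A compact connected metric graph, presented by one of its models: a finite
   multigraph (loops and parallel edges allowed) with positive edge lengths.
   The orientation src -> tgt of an edge only serves to parametrize it. *)
Record metric_graph (R : realType) := MetricGraph {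
  vertex : finType;
  edge : finType;
  src : edge -> vertex;
  tgt : edge -> vertex;
  len : edge -> R;
  len_gt0 : forall e, 0 < len e;
  mg_connected : graph_connected src tgt predT
}.

(* The set underlying the geometric realization: the vertices and, for every
   edge e, an open interval of length [len e]. *)
Inductive mg_point (R : realType) (G : metric_graph R) : Type :=
| Vertex of vertex G
| Interior (e : edge G) of {t : R | 0 < t < len e}.

Arguments Vertex {R G}.
Arguments Interior {R G}.

Section MetricGraph.
Variables (R : realType) (G : metric_graph R).

(* The gluing map [0, len e] -> G; parameters outside are clamped. *)
Definition edge_pt (e : edge G) (t : R) : mg_point G :=
  if insub t is Some u then Interior e u
  else Vertex (if t <= 0 then src e else tgt e).

(* An oriented edge (e, b) is e traversed from src to tgt if b = true, and
   from tgt to src if b = false. *)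
Definition origin (d : edge G * bool) : vertex G :=
  if d.2 then src d.1 else tgt d.1.

(* Outgoing directions at a point, coded by oriented edges; a loop contributes
   two directions at its vertex. *)
Definition directions (p : mg_point G) : {set edge G * bool} :=
  match p with
  | Vertex v => [set d | origin d == v]%SET
  | Interior e _ => [set d | d.1 == e]%SET
  end.

Definition valence (p : mg_point G) : nat := #|directions p|.

Definition edge_coord (p : mg_point G) (d : edge G * bool) : R :=
  match p with
  | Vertex _ => if d.2 then 0 else len d.1
  | Interior _ t => val t
  end.

(* The point reached from p after travelling a length h in the direction d, for
   d \in directions p and h >= 0 small. *)
Definition depart (p : mg_point G) (d : edge G * bool) (h : R) : mg_point G :=
  edge_pt d.1 (edge_coord p d + (if d.2 then h else - h)).

(* The pieces are closed intervals, so f is continuous on [0, l]. *)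
Definition pl_on (l : R) (f : R -> R) : Prop :=
  exists (n : nat) (t : nat -> R) (s : nat -> int),
    [/\ t 0%N = 0, t n = l,
        forall i, (i < n)%N -> t i < t i.+1 &
        forall i x, (i < n)%N -> t i <= x <= t i.+1 ->
          f x = f (t i) + (s i)%:~R * (x - t i)].

(* Continuous piecewise linear functions with integer slopes; continuity at the
   vertices holds since [edge_pt e] sends 0 and [len e] to vertices. *)
Definition piecewise_linear (psi : mg_point G -> R) : Prop :=
  forall e : edge G, pl_on (len e) (fun t => psi (edge_pt e t)).

(* The default value 0 of [xget] is never used when psi is piecewise linear and
   d \in directions p. *)
Definition outgoing_slope (psi : mg_point G -> R) (p : mg_point G)
    (d : edge G * bool) : int :=
  xget 0 [set s : int | exists2 eps : R, 0 < eps &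
    forall h, 0 <= h <= eps -> psi (depart p d h) = psi p + s%:~R * h].

(* Divisors are represented by their multiplicities, as functions to int; those
   occurring below have finite support. *)
Definition divisor := mg_point G -> int.

Definition effective (D : divisor) : Prop := forall p, 0 <= D p.

Definition divisor_of (psi : mg_point G -> R) : divisor :=
  fun p => - \sum_(d in directions p) outgoing_slope psi p d.

Definition canonical : divisor := fun p => (valence p)%:Z - 2.

Definition Rspace (D : divisor) : set (mg_point G -> R) :=
  [set psi | piecewise_linear psi /\
             effective (fun p => divisor_of psi p + D p)].

Definition twoRK : set (mg_point G -> R) :=
  [set psi1 \+ psi2 | psi1 in Rspace canonical & psi2 in Rspace canonical].

Definition tropically_dependent (n : nat) (psi : 'I_n -> mg_point G -> R) : Prop :=
  exists b : 'I_n -> R, forall p : mg_point G, exists i j : 'I_n,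
    [/\ i != j,
        forall k, psi i p + b i <= psi k p + b k &
        forall k, psi j p + b j <= psi k p + b k].

Definition tropically_independent (n : nat) (psi : 'I_n -> mg_point G -> R) : Prop :=
  ~ tropically_dependent psi.

(* The model carried by G is trivalent; ranging over all G with this property
   ranges over all metric graphs that admit a trivalent model. *)
Definition trivalent : Prop := forall v : vertex G, valence (Vertex v) = 3%N.

Definition three_edge_connected : Prop :=
  forall e1 e2 : edge G, e1 != e2 ->
    graph_connected (@src R G) (@tgt R G) [pred e | (e != e1) && (e != e2)].

(* The cellular boundary map of the model, acting on row vectors:
   e |-> tgt e - src e. *)
Definition boundary : 'M[rat]_(#|edge G|, #|vertex G|) :=
  \matrix_(i, j) ((tgt (enum_val i) == enum_val j)%:R
                  - (src (enum_val i) == enum_val j)%:R).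

(* dim H_1(G; rat), the group H_1 being the kernel of the boundary map. *)
Definition betti1 : nat := \rank (kermx boundary).

End MetricGraph.

(* Main.v *)
Require Import Defs.
From mathcomp Require Import all_boot all_order all_algebra.
From mathcomp Require Import zify ring lra.
From mathcomp Require Import boolp classical_sets reals.

Set Implicit Arguments.
Unset Strict Implicit.
Unset Printing Implicit Defensive.

Import Order.TTheory GRing.Theory Num.Theory.

Local Open Scope ring_scope.

(* In a trivalent 3-edge-connected graph every edge e lies on two cycles C, C'
   with no other common edge: two edge-disjoint paths joining the ends of e in
   G - e exist by Menger's theorem, proved here by augmenting a circulation.  For
   small eps > 0 the function min (eps, dist (., C)) belongs to R(K), because a
   vertex of C has at most one direction leaving C.  So
   f_e = min (eps, dist (., C)) + min (eps, dist (., C')) lies in 2R(K), vanishes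
   on e and is positive in the interior of every other edge.  Evaluation at the
   midpoints then shows that the f_e are independent: if min_e (f_e + b_e) were
   attained twice everywhere, take e with b_e minimal and look at the midpoint of
   e.  Finally 3g - 3 is the number of edges. *)

(** * Integral circulations, and two cycles sharing only a given edge *)

Section Circulations.
Variables (V E : finType) (src tgt : E -> V).

Definition tail (d : E * bool) : V := if d.2 then src d.1 else tgt d.1.
Definition head (d : E * bool) : V := if d.2 then tgt d.1 else src d.1.

(* Kirchhoff's law tested against all potentials f; for f the indicator of S it
   says that the net flow into S vanishes. *)
Definition circulation (y : E -> int) : Prop :=
  forall f : V -> int, \sum_k y k * (f (tgt k) - f (src k)) = 0.

Definition closed_under (A : pred (E * bool)) (S : {set V}) : Prop :=
  forall d, A d -> tail d \in S -> head d \in S.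

Lemma graph_connected_closed (A : pred E) (S : pred V) :
  graph_connected src tgt A ->
  (forall k, A k -> S (src k) = S (tgt k)) ->
  forall u v, S u -> S v.
Proof.
move=> [_ con] clS u v Su.
have /connectP [p] := con u v.
elim: p u Su => [|w p IHp] u Su /= => [_ -> //|/andP [/existsP [k /andP [Ak uw]]]].
apply: (IHp w); have := clS k Ak.
by case/orP: uw => /andP [/eqP -> /eqP ->]; rewrite Su.
Qed.

Lemma circulation_sum_cut (y : E -> int) (S : {set V}) : circulation y ->
  \sum_k y k * ((tgt k \in S)%:R - (src k \in S)%:R) = 0.
Proof. by move=> cy; apply: (cy (fun v => (v \in S)%:R)). Qed.

Lemma circulationD (y z : E -> int) :
  circulation y -> circulation z -> circulation (fun k => y k + z k).
Proof.
move=> cy cz f; under eq_bigr do rewrite mulrDl.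
by rewrite big_split /= cy cz addr0.
Qed.

Lemma circulationB (y z : E -> int) :
  circulation y -> circulation z -> circulation (fun k => y k - z k).
Proof.
move=> cy cz f; under eq_bigr do rewrite mulrBl.
by rewrite sumrB cy cz subr0.
Qed.

Lemma sum_edges_darts (h : E * bool -> int) :
  \sum_d h d = \sum_k (h (k, true) + h (k, false)).
Proof.
transitivity (\sum_k \sum_(b : bool) h (k, b)).
  by rewrite pair_big; apply: eq_bigr => -[].
by apply: eq_bigr => k _; rewrite big_bool.
Qed.

(** Reachability of [src e] from [tgt e] along [A] is phrased by closed sets, ready for cut
    arguments. A path of distinct oriented edges joining them, closed up by [e], is a closed walk,
    and [y] counts its net passages through each edge. *)
Lemma unit_circulation (e : E) (A : pred (E * bool)) :
  (forall d, A d -> d.1 != e) ->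
  (forall S, closed_under A S -> tgt e \in S -> src e \in S) ->
  exists y : E -> int,
    [/\ circulation y, y e = 1 &
        forall k, k != e ->
          [\/ y k = 0, y k = 1 /\ A (k, true) | y k = -1 /\ A (k, false)]].
Proof.
move=> Ae reach.
pose r d d' := (head d == tail d') && A d'.
pose S := [set head d | d in connect r (e, true)]%SET.
have clS : closed_under A S.
  move=> d Ad /imsetP [d1 cd1 hd1]; apply/imsetP; exists d => //.
  by apply: connect_trans cd1 (connect1 _); rewrite /r -hd1 eqxx Ad.
have /imsetP [d /connectP [p0 rp0 dlast] hd] : src e \in S.
  by apply: reach => //; apply/imsetP; exists (e, true) => //; apply: connect0.
case: (shortenP rp0) dlast => p rp up _ dlast.
have pA d' : d' \in p -> A d'.
  move: rp; clear; elim: p (e, true) => // d1 p IHp d0 /=.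
  by case/andP=> /andP [_ A1] /IHp H; rewrite inE => /predU1P [->|/H].
pose s := (e, true) :: p.
(* Telescoping along the walk; it closes up since [head d] is [src e], which is Kirchhoff's law for
   the net count. *)
have tele f : \sum_(d' <- s) (f (head d') - f (tail d')) = f (head d) - f (src e) :> int.
  rewrite dlast /s -[src e]/(tail (e, true)); move: rp; clear.
  elim: p (e, true) => [|d1 p IHp] d0 /=; first by rewrite big_seq1.
  case/andP=> /andP [/eqP hd0 _] /IHp; rewrite big_cons => -> /=.
  by rewrite hd0; ring.
exists (fun k => ((k, true) \in s)%:R - ((k, false) \in s)%:R); split.
- move=> f; have := tele f; rewrite -hd subrr; apply: etrans.
  rewrite [RHS]big_uniq // [RHS]big_mkcond sum_edges_darts.
  apply: eq_bigr => k _; rewrite /head /tail /=.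
  by do 2 case: (_ \in _) => /=; ring.
- have /negbTE -> : (e, false) \notin s.
    by rewrite /s inE xpair_eqE andbF /=; apply/negP => /pA /Ae; rewrite eqxx.
  by rewrite /s inE eqxx subr0.
- move=> k ke; have inp b : (k, b) \in s -> A (k, b).
    rewrite /s inE => /predU1P [[kE _]|]; [by rewrite kE eqxx in ke | exact: pA].
  case: (boolP ((k, true) \in s)) => /= [/inp|] Ht;
    case: (boolP ((k, false) \in s)) => /= [/inp|] Hf.
  + by constructor 1; rewrite subrr.
  + by constructor 2; rewrite subr0.
  + by constructor 3; rewrite sub0r.
  + by constructor 1; rewrite subrr.
Qed.

(* The supports of y and z contain the two cycles through e; z is the residue of
   an integral flow with value 2 on e after removing the unit circulation y. *)
Lemma theta_circulations (e k : E) : k != e ->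
  (forall e1 e2, e1 != e2 ->
     graph_connected src tgt [pred e' | (e' != e1) && (e' != e2)]) ->
  exists y z : E -> int,
    [/\ circulation y, circulation z, y e != 0, z e != 0 &
        forall k, k != e -> (y k == 0) || (z k == 0)].
Proof.
move=> ke con3.
(* A cut separating the ends of [e] contains a further edge besides [e] and any prescribed [e1];
   applied twice, this gives two edges other than [e] in the cut. *)
have cut2 (S : {set V}) e1 : e1 != e -> tgt e \in S -> src e \notin S ->
    exists2 k', k' != e & k' != e1 /\ (src k' \in S) != (tgt k' \in S).
  move=> e1e tS /negP sS; apply: contrapT => nocross; apply: sS.
  apply: (@graph_connected_closed _ (fun v => v \in S) (con3 _ _ e1e) _ _ _ tS).
  move=> k' /andP [k'1 k'e]; apply/eqP; apply/negPn/negP => cr.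
  by apply: nocross; exists k'.
have [|S clS tS|y [cy ye y1]] := @unit_circulation e (fun d => d.1 != e) => //.
  apply/negPn/negP => sS; have [k' k'e [_ /negP]] := cut2 S k ke tS sS; apply.
  have := clS (k', true) k'e; have := clS (k', false) k'e; rewrite /tail /head /=.
  by case: (_ \in _); case: (_ \in _) => // H1 H2; rewrite ?H1 ?H2.
pose sg (b : bool) : int := if b then 1 else -1.
(* Augmentation in the residual graph: [x] may cancel an edge of [y] but not repeat it in the same
   direction, so [y + x] is 2 on [e] and stays in -1, 0, 1 elsewhere. *)
have [|S clS tS|x [cx xe x1]] :=
  @unit_circulation e (fun d => (d.1 != e) && (y d.1 != sg d.2)).
- by move=> d /andP [].
- apply/negPn/negP => sS.
  (* Every edge k' != e crossing S carries one unit of y out of S, while e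
     carries one unit into S: hence only one such edge exists. *)
  have crossE k' : k' != e ->
      y k' * ((tgt k' \in S)%:R - (src k' \in S)%:R)
      = - ((src k' \in S) != (tgt k' \in S))%:R.
    move=> k'e; have := clS (k', true); have := clS (k', false).
    rewrite /tail /head /sg /= k'e /=.
    case: (src k' \in S); case: (tgt k' \in S) => //= H1 H2; rewrite ?subrr ?mulr0 //.
    + by case: eqP H2 => [->|_ /(_ isT isT)//]; lia.
    + by case: eqP H1 => [->|_ /(_ isT isT)//]; lia.
  have := circulation_sum_cut S cy.
  rewrite (bigD1 e) //= ye tS (negbTE sS) subr0 mulr1 => sum0.
  have [k1 k1e [_ k1S]] := cut2 S k ke tS sS.
  have [k2 k2e [k21 k2S]] := cut2 S k1 k1e tS sS.
  move: sum0; rewrite (bigD1 k1) //= crossE // k1S (bigD1 k2) /=; last by rewrite k2e.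
  rewrite crossE // k2S.
  have : \sum_(i | (i != e) && (i != k1) && (i != k2))
      y i * ((tgt i \in S)%:R - (src i \in S)%:R) <= 0 :> int.
    by apply: sumr_le0 => i /andP [/andP [ie _] _]; rewrite crossE // oppr_le0.
  by move: (\sum_(_ | _) _) => w; lia.
have cz := circulationD cy cx.
pose z k := y k + x k; rewrite -/z in cz.
have z1 k' : k' != e -> [\/ z k' = 0, z k' = 1 | z k' = -1].
  move=> k'e; rewrite /z; have := y1 k' k'e; have := x1 k' k'e; rewrite /sg /= k'e /=.
  case=> [->|[-> xn1]|[-> xn1]] [yk|[yk _]|[yk _]]; rewrite yk;
    first [by constructor 1 | by constructor 2 | by constructor 3
          | by rewrite yk in xn1].
(* Off [e], [p] only follows the direction of the flow [z], hence agrees with [z] wherever it is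
   nonzero; so [z - p] vanishes there, while on [e] it is 2 - 1. *)
have [|S clS tS|p [cp pe p1]] :=
  @unit_circulation e (fun d => (d.1 != e) && (z d.1 == sg d.2)).
- by move=> d /andP [].
- apply/negPn/negP => sS; have := circulation_sum_cut S cz.
  rewrite (bigD1 e) //= {1}/z ye xe tS (negbTE sS) subr0 mulr1.
  (* An edge carrying [z] out of [S] would be an allowed direction leaving a closed set. So nothing
     balances the 2 units that [e] brings into [S]. *)
  have : 0 <= \sum_(i | i != e) z i * ((tgt i \in S)%:R - (src i \in S)%:R) :> int.
    apply: sumr_ge0 => i ie; have := clS (i, true); have := clS (i, false).
    rewrite /tail /head /sg /= ie /=.
    case: (src i \in S); case: (tgt i \in S) => //=; case: (z1 i ie) => -> //=;
    by move=> H1 H2; (have := H1 isT isT) || (have := H2 isT isT).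
  by move: (\sum_(_ | _) _) => w; lia.
exists p, (fun k => z k - p k); split.
- by [].
- exact: circulationB.
- by rewrite pe.
- by rewrite /z ye xe pe.
- move=> k' k'e; have [->|[-> /andP [_ /eqP ->]]|[-> /andP [_ /eqP ->]]] := p1 k' k'e.
  + by rewrite eqxx.
  + by rewrite subrr orbT.
  + by rewrite subrr orbT.
Qed.

(** Kirchhoff's law at [tail d]: a single outgoing direction with nonzero flow could not be
    balanced. A loop provides both of its directions. *)
Lemma circulation_two_directions (y : E -> int) (d : E * bool) :
  circulation y -> y d.1 != 0 ->
  exists2 d', d' != d & tail d' = tail d /\ y d'.1 != 0.
Proof.
move=> cy yd; apply: contrapT => alone.
have : \sum_k y k * ((tgt k == tail d)%:R - (src k == tail d)%:R) = 0 :> int.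
  exact: (cy (fun v => (v == tail d)%:R)).
pose h d' := (if d'.2 then -1 else 1) * (y d'.1 * (tail d' == tail d)%:R) : int.
rewrite (eq_bigr (fun k => h (k, true) + h (k, false))); last first.
  by move=> k _; rewrite /h /tail /=; ring.
rewrite -sum_edges_darts (bigD1 d) //= big1 ?addr0 => [|d' d'd].
  rewrite /h eqxx mulr1 => /eqP; rewrite mulf_eq0 (negbTE yd) orbF.
  by case: d.2.
rewrite /h; case: eqP => [td|]; last by rewrite !mulr0.
case: (eqVneq (y d'.1) 0) => [->|yd']; first by rewrite mul0r mulr0.
by case: alone; exists d'.
Qed.

End Circulations.

(** * Edge count, and a criterion for tropical independence *)

Section EdgeCount.
Variables (R : realType) (G : metric_graph R).

(** The upper bound for [betti1] in Euler's formula, by rank-nullity: a potential killed by the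
    transposed boundary map is constant on a connected graph, so the rank is at least the number of
    vertices minus 1. *)
Lemma betti1_bound : (betti1 G + #|vertex G| <= #|edge G| + 1)%N.
Proof.
rewrite /betti1 mxrank_ker.
have := rank_leq_row (boundary G).
suff : (#|vertex G| - \rank (boundary G) <= 1)%N by lia.
rewrite -mxrank_tr -mxrank_ker.
suff /mxrankS /leq_trans : (kermx (boundary G)^T <= (const_mx 1 : 'rV[rat]_#|vertex G|))%MS.
  by apply; apply: rank_leq_row.
apply/rV_subP => x /sub_kermxP xB.
have [/card_gt0P [u0 _] _] := mg_connected G.
pose val_at v := x 0 (enum_rank v).
suff xconst v : val_at v = val_at u0.
  apply/sub_rVP; exists (val_at u0); apply/rowP => j.
  by rewrite !mxE mulr1 -[j]enum_valK -(xconst (enum_val j)).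
apply/eqP.
apply: (@graph_connected_closed _ _ _ _ predT (fun v => val_at v == val_at u0)
          (mg_connected G) _ u0) => // k _.
suff -> : val_at (src k) = val_at (tgt k) by [].
have /rowP /(_ (enum_rank k)) := xB; rewrite !mxE.
under eq_bigr do rewrite !mxE enum_rankK mulrBr.
rewrite sumrB.
have pick w : \sum_i x 0 i * (w == enum_val i)%:R = val_at w.
  rewrite (bigD1 (enum_rank w)) //= enum_rankK eqxx mulr1 big1 ?addr0 // => i ne.
  by rewrite -(inj_eq enum_rank_inj) enum_valK eq_sym (negbTE ne) mulr0.
by rewrite !pick => /eqP; rewrite subr_eq0 => /eqP.
Qed.

Lemma trivalent_handshake : trivalent G -> (3 * #|vertex G| = 2 * #|edge G|)%N.
Proof.
move=> tri.
have -> : (2 * #|edge G| = #|{: edge G * bool}|)%N by rewrite card_prod card_bool mulnC.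
rewrite -[RHS]sum1_card (partition_big (@origin R G) predT) //=.
rewrite (eq_bigr (fun=> 3%N)); first by rewrite sum_nat_const mulnC.
move=> v _; rewrite -(tri v) /valence -sum1_card.
by apply: eq_bigl => d; rewrite inE.
Qed.

(** A single edge has only two oriented versions, too few for a vertex of valence 3. *)
Lemma trivalent_other_edge : trivalent G -> forall e : edge G, exists k, k != e.
Proof.
move=> tri e; apply: contrapT => only.
have := tri (src e); apply/eqP; rewrite neq_ltn; apply/orP; left.
apply: (@leq_ltn_trans #|[set (e, true); (e, false)]%SET|); last by rewrite cards2; case: eqP.
apply/subset_leq_card/fintype.subsetP => -[k b] _.
have -> : k = e by apply/eqP/negPn/negP => ke; apply: only; exists k.
by rewrite !inE !xpair_eqE eqxx; case: b.
Qed.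

Lemma tropically_independent_witness (n : nat) (psi : 'I_n -> mg_point G -> R)
    (p : 'I_n -> mg_point G) :
  (forall i, psi i (p i) = 0) ->
  (forall i j, i != j -> 0 < psi j (p i)) ->
  tropically_independent psi.
Proof.
move=> psi0 psi_gt0 [b dep].
(* Dependence at some vertex supplies an index, so that [b] has a minimum; this also settles the
   empty family. *)
have [/card_gt0P [u0 _] _] := mg_connected G.
have [i0 _] := dep (Vertex u0).
case: (@arg_minP _ R 'I_n i0 predT b isT) => i _ bmin.
have small j : (forall k, psi j (p i) + b j <= psi k (p i) + b k) -> j = i.
  move=> /(_ i); rewrite psi0 add0r => le_i.
  apply/eqP/negPn/negP; rewrite eq_sym => /psi_gt0 pos.
  by have := bmin j isT; lra.
have [j [k [jk /small ji /small ki]]] := dep (p i).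
by rewrite ji ki eqxx in jk.
Qed.

End EdgeCount.

(** * One-sided linear germs and their minima *)

Section LinearGerms.
Variable R : realType.

Definition linear_germ (f : R -> R) (s : int) : Prop :=
  exists2 eps : R, 0 < eps & forall h, 0 <= h <= eps -> f h = f 0 + s%:~R * h.

Lemma linear_germ_eq (f g : R -> R) (s : int) (eps : R) : 0 < eps ->
  (forall h, 0 <= h <= eps -> f h = g h) -> linear_germ f s -> linear_germ g s.
Proof.
move=> eps0 fg [del del0 fs]; exists (Num.min eps del) => [|h].
  by rewrite lt_min eps0.
rewrite le_min => /and3P [h0 he hd].
by rewrite -fg ?h0 // -fg ?lexx ?(ltW eps0) // fs ?h0.
Qed.

Lemma linear_germ_min_lt (f g : R -> R) (s r : int) : f 0 < g 0 ->
  linear_germ f s -> linear_germ g r -> linear_germ (fun h => Num.min (f h) (g h)) s.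
Proof.
move=> fg [d1 d10 f1] [d2 d20 g2].
(* [K] bounds the rate at which the gap between [f] and [g] closes; the summand 1 keeps it
   positive. *)
pose K := `|s%:~R| + `|r%:~R| + 1 : R.
have K0 : 0 < K by rewrite /K; have := normr_ge0 (s%:~R : R); have := normr_ge0 (r%:~R : R); lra.
have fg0 : 0 < (g 0 - f 0) / K by rewrite divr_gt0 ?subr_gt0.
apply: (@linear_germ_eq f _ _ (Num.min d1 (Num.min d2 ((g 0 - f 0) / K)))).
- by rewrite !lt_min d10 d20.
- move=> h; rewrite !le_min => /and4P [h0 h1 h2].
  rewrite ler_pdivlMr // => h3.
  have s1 : s%:~R * h <= `|s%:~R| * h by rewrite ler_wpM2r // ler_norm.
  have r1 : - (r%:~R * h) <= `|r%:~R| * h by rewrite -mulNr ler_wpM2r // -normrN ler_norm.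
  rewrite min_l // f1 ?h0 // g2 ?h0 //; rewrite /K in h3; lra.
- by exists d1.
Qed.

Lemma linear_germ_min (f g : R -> R) (s r : int) :
  linear_germ f s -> linear_germ g r ->
  exists q, linear_germ (fun h => Num.min (f h) (g h)) q.
Proof.
move=> fs gr; case: (ltgtP (f 0) (g 0)) => fg.
- by exists s; apply: linear_germ_min_lt gr.
- exists r; apply: (@linear_germ_eq (fun h => Num.min (g h) (f h)) _ _ 1) => //.
    by move=> h _; rewrite minC.
  exact: linear_germ_min_lt fs.
(* At a tie, the germ of smaller slope is the minimum for small [h >= 0]. *)
- wlog sr : f g s r fs gr fg / s <= r.
    move=> W; case: (leP s r) => [/(W _ _ _ _ fs gr fg) //|/ltW rs].
    have [q Q] := W _ _ _ _ gr fs (esym fg) rs.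
    by exists q; apply: linear_germ_eq Q => // h _; rewrite minC.
  exists s; move: fs gr => [d1 d10 f1] [d2 d20 g2].
  apply: (@linear_germ_eq f _ _ (Num.min d1 d2)); last by exists d1.
    by rewrite lt_min d10.
  move=> h; rewrite le_min => /and3P [h0 h1 h2].
  rewrite min_l // f1 ?h0 // g2 ?h0 // fg lerD2l ler_wpM2r //.
  by rewrite ler_int.
Qed.

Lemma linear_germ_unique (f : R -> R) (s r : int) :
  linear_germ f s -> linear_germ f r -> s = r.
Proof.
move=> [d1 d10 f1] [d2 d20 f2].
pose h := Num.min d1 d2.
have h0 : 0 < h by rewrite lt_min d10.
have e1 : f h = f 0 + s%:~R * h by apply: f1; rewrite ltW //= ge_min lexx.
have e2 : f h = f 0 + r%:~R * h by apply: f2; rewrite ltW //= ge_min lexx orbT.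
have /eqP : s%:~R * h = r%:~R * h by apply: (addrI (f 0)); rewrite -e1 -e2.
by rewrite (inj_eq (mulIf (lt0r_neq0 h0))) eqr_int => /eqP.
Qed.

End LinearGerms.

(** [outgoing_slope] is a choice by [xget]; uniqueness of the slope of a germ determines its
    value. *)
Lemma outgoing_slopeE (R : realType) (G : metric_graph R) (psi : mg_point G -> R)
    p d (s : int) :
  psi (depart p d 0) = psi p -> linear_germ (fun h => psi (depart p d h)) s ->
  outgoing_slope psi p d = s.
Proof.
move=> psi0 ps; apply: xget_unique => [|r [del del0 pr]].
  by case: ps => del del0 ps; exists del => // h /ps ->; rewrite psi0.
by apply: linear_germ_unique ps; exists del => // h /pr ->; rewrite psi0.
Qed.

(** * The truncated distance to a subgraph, and its divisor *)

Section TruncatedDistance.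
Variables (R : realType) (G : metric_graph R).
Variables (C : pred (edge G)) (eps : R).
Hypothesis eps_gt0 : 0 < eps.
Hypothesis eps_small : forall k : edge G, 2 * eps < len k.

Definition touches (v : vertex G) : bool := [exists d, C d.1 && (origin d == v)].

(** Every edge is longer than [eps], so the distance from a vertex off [C] to [C] is always
    truncated to [eps]. *)
Definition vertex_height (v : vertex G) : R := if touches v then 0 else eps.

Definition edge_height (k : edge G) (t : R) : R :=
  if C k then 0 else
  Num.min eps (Num.min (vertex_height (src k) + t)
                       (vertex_height (tgt k) + (len k - t))).

Definition truncated_distance (p : mg_point G) : R :=
  match p with
  | Vertex v => vertex_height v
  | Interior k t => edge_height k (val t)
  end.

Lemma touches_src k : C k -> touches (src k).
Proof. by move=> Ck; apply/existsP; exists (k, true); rewrite Ck eqxx. Qed.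

Lemma touches_tgt k : C k -> touches (tgt k).
Proof. by move=> Ck; apply/existsP; exists (k, false); rewrite Ck eqxx. Qed.

Lemma min3_eq (a b c m : R) : m <= a -> m <= b -> m <= c ->
  [\/ m = a, m = b | m = c] -> Num.min a (Num.min b c) = m.
Proof.
move=> ma mb mc mE; apply/le_anti; rewrite !le_min ma mb mc !andbT !ge_min.
by case: mE => <-; rewrite lexx ?orbT.
Qed.

Lemma vertex_height_cases v :
  touches v /\ vertex_height v = 0 \/ ~~ touches v /\ vertex_height v = eps.
Proof. by rewrite /vertex_height; case: touches; [left | right]. Qed.

Ltac solve_min3 :=
  apply: min3_eq; try lra;
  first [by constructor 1; lra | by constructor 2; lra | by constructor 3; lra].

(** Off [C] an edge splits into two end collars of width [eps] and a plateau. As [2 * eps < len k],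
    the far end contributes at least [eps] inside a collar. *)
Lemma edge_height_src k t : ~~ C k -> 0 <= t <= eps ->
  edge_height k t = vertex_height (src k) + (touches (src k))%:R * t.
Proof.
move=> /negbTE Ck tb; have e2 := eps_small k; have e0 := eps_gt0.
rewrite /edge_height Ck.
have [[-> ->]|[/negbTE -> ->]] := vertex_height_cases (src k);
have [[_ ->]|[_ ->]] := vertex_height_cases (tgt k); rewrite ?mul1r ?mul0r; solve_min3.
Qed.

Lemma edge_height_mid k t : ~~ C k -> eps <= t <= len k - eps ->
  edge_height k t = eps.
Proof.
move=> /negbTE Ck tb; have e2 := eps_small k; have e0 := eps_gt0.
rewrite /edge_height Ck.
have [[_ ->]|[_ ->]] := vertex_height_cases (src k);
have [[_ ->]|[_ ->]] := vertex_height_cases (tgt k); solve_min3.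
Qed.

Lemma edge_height_tgt k t : ~~ C k -> len k - eps <= t <= len k ->
  edge_height k t = vertex_height (tgt k) + (touches (tgt k))%:R * (len k - t).
Proof.
move=> /negbTE Ck tb; have e2 := eps_small k; have e0 := eps_gt0.
rewrite /edge_height Ck.
have [[_ ->]|[_ ->]] := vertex_height_cases (src k);
have [[-> ->]|[/negbTE -> ->]] := vertex_height_cases (tgt k);
rewrite ?mul1r ?mul0r; solve_min3.
Qed.

Lemma truncated_distance_edge k t : 0 <= t <= len k ->
  truncated_distance (edge_pt k t) = edge_height k t.
Proof.
move=> /andP [t0 tl]; have e2 := eps_small k; have e0 := eps_gt0.
rewrite /edge_pt; case: insubP => [u _ <- //|nin].
have [Ck|nCk] := boolP (C k); case: leP => t0' /=.
- by rewrite /edge_height Ck /vertex_height touches_src.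
- by rewrite /edge_height Ck /vertex_height touches_tgt.
- have -> : t = 0 by lra.
  by rewrite edge_height_src //; [ring | lra].
- have -> : t = len k.
    by apply/le_anti; rewrite tl /= leNgt; apply/negP => t1; rewrite t0' t1 in nin.
  by rewrite edge_height_tgt //; [ring | lra].
Qed.

Lemma truncated_distance_pl : piecewise_linear truncated_distance.
Proof.
move=> k; have e2 := eps_small k; have e0 := eps_gt0.
(* The default value [len k] of [nth] is the last breakpoint, with index 3. *)
exists 3%N, (fun i => nth (len k) [:: 0; eps; len k - eps] i),
  (fun i => if C k then 0
            else nth 0 [:: (touches (src k))%:Z; 0; - (touches (tgt k))%:Z] i).
split=> //.
  by case=> [|[|[|]]] //= _; lra.
have [Ck|nCk] := boolP (C k).
  case=> [|[|[|]]] //= x _ xb; rewrite !truncated_distance_edge ?/edge_height ?Ck;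
    rewrite ?mul0r ?addr0 //; lra.
case=> [|[|[|]]] //= x _ xb; rewrite !truncated_distance_edge; try lra.
- by rewrite !edge_height_src //; lra.
- by rewrite !edge_height_mid //; lra.
- by rewrite !edge_height_tgt // ?mulrNz; lra.
Qed.

Lemma truncated_distance_slope_vertex d :
  outgoing_slope truncated_distance (Vertex (origin d)) d
  = (touches (origin d) && ~~ C d.1)%:Z.
Proof.
have e2 := eps_small d.1; have e0 := eps_gt0.
have departE h : 0 <= h <= eps ->
    truncated_distance (depart (Vertex (origin d)) d h)
    = vertex_height (origin d) + (touches (origin d) && ~~ C d.1)%:R * h.
  case: d e2 => k b /= e2 hb; rewrite /depart /origin /=.
  have [Ck|nCk] := boolP (C k).
    rewrite truncated_distance_edge; last by case: b; lra.
    rewrite /edge_height Ck /vertex_height.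
    by case: b; rewrite (touches_src, touches_tgt) // andbF mul0r addr0.
  rewrite andbT truncated_distance_edge; last by case: b; lra.
  case: b; first by rewrite add0r edge_height_src.
  rewrite edge_height_tgt //; last by lra.
  by congr (_ + _ * _); ring.
have depart0 := departE 0; rewrite mulr0 addr0 in depart0.
apply: outgoing_slopeE; first by apply: depart0; lra.
by exists eps => // h /departE ->; rewrite depart0 //; lra.
Qed.

(** Slopes exist in both directions, as a minimum of affine functions of integer slope has a germ of
    integer slope; this excludes the default value in [outgoing_slope]. *)
Lemma edge_height_germ k (t s : R) :
  s = 1 \/ s = -1 -> exists q, linear_germ (fun h => edge_height k (t + s * h)) q.
Proof.
move=> s1; have [z sz] : exists z : int, s = z%:~R.
  by case: s1 => ->; [exists 1 | exists (-1)].
rewrite /edge_height; case: (C k).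
  by exists 0; exists 1 => // h _; rewrite mul0r addr0.
have germ1 : linear_germ (fun=> eps) 0 by exists 1 => // h _; rewrite mul0r addr0.
have germ2 : linear_germ (fun h => vertex_height (src k) + (t + s * h)) z.
  by exists 1 => // h _; rewrite -sz; ring.
have germ3 : linear_germ (fun h => vertex_height (tgt k) + (len k - (t + s * h))) (- z).
  by exists 1 => // h _; rewrite mulrNz -sz; ring.
have [q germ23] := linear_germ_min germ2 germ3.
exact: linear_germ_min germ1 germ23.
Qed.

(** A minimum of affine functions is concave; the midpoint form compares the two opposite slopes
    directly. *)
Lemma edge_height_concave k t h :
  edge_height k (t + h) + edge_height k (t - h) <= 2 * edge_height k t.
Proof.
rewrite /edge_height; case: (C k); first by lra.
set a := vertex_height _; set b := vertex_height _; set l := len k.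
have [m E] : exists m, Num.min eps (Num.min (a + t) (b + (l - t))) = m by eexists.
have min_le x y z : [/\ Num.min x (Num.min y z) <= x, Num.min x (Num.min y z) <= y
                      & Num.min x (Num.min y z) <= z :> R].
  by rewrite !ge_min !lexx !orbT.
have [p1 p2 p3] := min_le eps (a + (t + h)) (b + (l - (t + h))).
have [q1 q2 q3] := min_le eps (a + (t - h)) (b + (l - (t - h))).
have : [\/ m = eps, m = a + t | m = b + (l - t)].
  rewrite -E; case: (leP (a + t)) => _; case: leP => _;
    by [constructor 1 | constructor 2 | constructor 3].
by rewrite E; case=> ->; lra.
Qed.

Lemma truncated_distance_slope_interior k t :
  outgoing_slope truncated_distance (Interior k t) (k, true)
  + outgoing_slope truncated_distance (Interior k t) (k, false) <= 0.
Proof.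
pose x : R := val t; have /andP [x0 xl] : 0 < x < len k := valP t.
pose del := Num.min x (len k - x).
have del0 : 0 < del by rewrite lt_min x0 subr_gt0.
pose sg (b : bool) : R := if b then 1 else -1.
have departE b h : 0 <= h <= del ->
    truncated_distance (depart (Interior k t) (k, b) h) = edge_height k (x + sg b * h).
  rewrite le_min => hb; rewrite /depart /=.
  have -> : (if b then h else - h) = sg b * h by case: b; rewrite /sg; ring.
  by rewrite truncated_distance_edge // -/x /sg; case: b; lra.
have germ b : exists2 q, linear_germ (fun h => edge_height k (x + sg b * h)) q &
    outgoing_slope truncated_distance (Interior k t) (k, b) = q.
  have [|q Q] := @edge_height_germ k x (sg b); first by case: b; [left | right].
  exists q => //; apply: outgoing_slopeE.
    by rewrite departE ?mulr0 ?addr0 // lexx ltW.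
  by apply: linear_germ_eq del0 _ Q => h /departE ->.
have [q [d1 d10 Q] ->] := germ true; have [r [d2 d20 P] ->] := germ false.
pose h := Num.min d1 d2.
have h0 : 0 < h by rewrite lt_min d10.
have := edge_height_concave k x h.
have := Q h; have := P h; rewrite /sg !mulr0 !addr0 mul1r mulN1r => -> => [->|].
- rewrite -(ler_int R) rmorphD /= => conc; rewrite -(pmulr_lle0 _ h0); lra.
- by rewrite ltW //= ge_min lexx.
- by rewrite ltW //= ge_min lexx orbT.
Qed.

Hypothesis Gtrivalent : trivalent G.
Hypothesis C_two_directions : forall d, C d.1 ->
  exists2 d', d' != d & origin d' = origin d /\ C d'.1.

(** The canonical divisor is 1 at vertices and 0 inside edges. At a vertex of [C], [d0] and [d1]
    stay in [C] and have slope 0, which leaves one direction of slope at most 1; inside edges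
    concavity decides. *)
Lemma truncated_distance_canonical : Rspace (@Defs.canonical R G) truncated_distance.
Proof.
split; first exact: truncated_distance_pl.
rewrite /effective /divisor_of /Defs.canonical => -[v|k t].
  rewrite Gtrivalent.
  rewrite (eq_bigr (fun d => (touches v && ~~ C d.1)%:Z)); last first.
    by move=> d; rewrite inE => /eqP <-; rewrite truncated_distance_slope_vertex.
  suff : \sum_(d in directions (Vertex v)) (touches v && ~~ C d.1)%:Z <= 1 by rewrite addrC subr_ge0.
  have [/existsP [d0 /andP [Cd0 /eqP od0]]|_] := boolP (touches v); last by rewrite big1.
  have [d1 d10 [od1 Cd1]] := C_two_directions Cd0.
  have card3 := Gtrivalent v; rewrite /valence in card3.
  have in0 : d0 \in directions (Vertex v) by rewrite inE od0.
  have in1 : d1 \in directions (Vertex v) by rewrite inE od1 od0.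
  rewrite (bigD1 d0) //= Cd0 (bigD1 d1) /=; last by rewrite in1.
  rewrite Cd1 !add0r.
  apply: le_trans (_ : \sum_(d in directions (Vertex v) :\ d0 :\ d1) 1 <= _)%R.
    rewrite big_mkcond [leRHS]big_mkcond; apply: ler_sum => d _.
    by rewrite !inE; case: (origin d == v); case: (d == d0); case: (d == d1) => //=; case: (C _).
  rewrite sumr_const.
  suff -> : #|directions (Vertex v) :\ d0 :\ d1| = 1%N by [].
  move: card3; rewrite (cardsD1 d0) in0 (cardsD1 d1) in_setD1 d10 in1 /=.
  by rewrite !add1n => -[].
have dirE : directions (Interior k t) = [set (k, true); (k, false)]%SET.
  by apply/setP => -[k' b]; rewrite !inE !xpair_eqE; case: b; rewrite ?andbT ?andbF ?orbF.
rewrite /valence dirE cards2 xpair_eqE andbF /= subr0.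
rewrite big_setU1 ?inE ?xpair_eqE ?andbF //= big_set1.
by rewrite oppr_ge0 truncated_distance_slope_interior.
Qed.

End TruncatedDistance.

(** * Choice of [eps] and assembly of the independent family *)

Lemma edge_lengths_lower_bound (R : realType) (G : metric_graph R) :
  exists2 eps : R, 0 < eps & forall k : edge G, 2 * eps < len k.
Proof.
(* Division by 3 makes [2 * eps < len k] strict. *)
exists (\big[Num.min/1]_(k : edge G) (len k / 3)).
  by elim/big_ind: _ => // [x y x0 y0|k _]; rewrite ?lt_min ?x0 // divr_gt0 // len_gt0.
move=> k; have := len_gt0 k.
have : \big[Num.min/1]_(k : edge G) (len k / 3) <= len k / 3 by apply: bigmin_le_cond.
lra.
Qed.

Theorem theorem1p4 (R : realType) (G : metric_graph R) (g : nat)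
  (Gtrivalent : trivalent G)
  (G3connected : three_edge_connected G)
  (Gbetti : betti1 G = g) :
  exists psi : 'I_(3 * g - 3)%N -> mg_point G -> R,
    [/\ injective psi,
        forall i, twoRK (psi i) &
        tropically_independent psi].
Proof.
(* With V vertices and E edges, [3V = 2E] turns [g + V <= E + 1] into [3g - 3 <= E]. *)
have le_n : (3 * g - 3 <= #|edge G|)%N.
  by have := betti1_bound G; have := trivalent_handshake Gtrivalent; lia.
have [eps eps0 eps_small] := edge_lengths_lower_bound G.
have mid_in (k : edge G) : 0 < len k / 2 < len k by have := len_gt0 k; lra.
pose mid k : mg_point G := Interior k (exist _ (len k / 2) (mid_in k)).
have mid_gt0 (C : pred (edge G)) k : ~~ C k -> 0 < truncated_distance C eps (mid k).
  move=> Ck; have ek := eps_small k; have lk := len_gt0 k.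
  rewrite /= edge_height_mid //=; lra.
have mid_ge0 (C : pred (edge G)) k : 0 <= truncated_distance C eps (mid k).
  by have [Ck|/mid_gt0/ltW//] := boolP (C k); rewrite /= /edge_height Ck.
have F (e : edge G) : exists f, [/\ twoRK f, f (mid e) = 0 &
    forall k, k != e -> 0 < f (mid k)].
  have [k ke] := trivalent_other_edge Gtrivalent e.
  have [y [z [cy cz ye ze yz]]] := theta_circulations ke G3connected.
  pose C y : pred (edge G) := fun k => (y k : int) != 0.
  have inRK x : circulation (@src R G) (@tgt R G) x ->
      Rspace (@Defs.canonical R G) (truncated_distance (C x) eps).
    move=> cx; apply: truncated_distance_canonical => // d xd.
    exact: circulation_two_directions cx xd.
  exists (truncated_distance (C y) eps \+ truncated_distance (C z) eps); split.
  - exists (truncated_distance (C y) eps); first exact: inRK.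
    by exists (truncated_distance (C z) eps) => //; apply: inRK.
  - by rewrite /= /edge_height /C ye ze addr0.
  (* The edge [j] is missed by one of the two supports, whose truncated distance is positive at
     [mid j]; the other one is nonnegative. *)
  - by move=> j /yz /orP [yj|zj]; [apply: ltr_wpDr | apply: ltr_wpDl];
      (apply: mid_ge0 || apply: mid_gt0); rewrite /C negbK.
have [f fP] := choice F.
pose ed i := enum_val (widen_ord le_n i).
have ed_inj : injective ed.
  by move=> i j /enum_val_inj /(congr1 val) /= /val_inj.
have f_ed i j : i != j -> 0 < f (ed j) (mid (ed i)).
  by move=> ij; have [_ _] := fP (ed j); apply; rewrite (inj_eq ed_inj).
exists (fun i => f (ed i)); split.
(* Equal functions for distinct edges would be both zero and positive at [mid (ed i)]. *)
- move=> i j fij; apply/eqP/negPn/negP => /f_ed.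
  by rewrite -fij; have [_ -> _] := fP (ed i); rewrite ltxx.
- by move=> i; have [] := fP (ed i).
- apply: (@tropically_independent_witness _ _ _ _ (fun i => mid (ed i))).
  + by move=> i; have [] := fP (ed i).
  + exact: f_ed.
Qed.
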